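(* The pseudoarc is homogeneous: if $X$ is the pseudoarc then for all $x,y\in X$ there is a homeomorphism $\phi$ of $X$ onto itself with $\phi(x)=y$.
   Context: A continuum is a connected metrisable compact space. A continuum is indecomposable if it is not the union of two proper subcontinua, and hereditarily indecomposable if all of its subcontinua are indecomposable; equivalently, for all subcontinua $Y,Z$ with $Y\cap Z\neq\emptyset$, either $Y\subseteq Z$ or $Z\subseteq Y$. A continuum is chainable if every open cover is refined by a chain, i.e. by a finite open cover which forms a path graph with respect to the overlap relation $O\cap N\neq\emptyset$ (its members can be enumerated as $O_0,\ldots,O_n$ so that $O_j\cap O_k\neq\emptyset$ if and only if $|j-k|\leq1$). A pseudoarc is a chainable hereditarily indecomposable continuum with more than one point. Pseudoarcs exist and any two of them are homeomorphic, so one speaks of ''the'' pseudoarc. *)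

(* Defs.v *)
From mathcomp Require Import all_boot all_order all_algebra.
From mathcomp Require Import all_classical all_reals topology.

Set Implicit Arguments.
Unset Strict Implicit.
Unset Printing Implicit Defensive.

Import Order.TTheory GRing.Theory Num.Theory.
Local Open Scope classical_set_scope.
Local Open Scope ring_scope.

Definition homeomorphism (X Y : topologicalType) (f : X -> Y) : Prop :=
  continuous f /\
  exists g : Y -> X, [/\ cancel f g, cancel g f & continuous g].

Definition metrizable (R : realType) (X : topologicalType) : Prop :=
  exists (M : metricType R) (f : X -> M), homeomorphism f.

Definition continuum (R : realType) (X : topologicalType) : Prop :=
  [/\ connected [set: X], compact [set: X] & metrizable R X].

(* [compact A] and [connected A] say that the subspace A is compact, resp.
   connected; metrizability passes to subspaces, so it is not repeated here.
   The empty set is admitted, which does not affect [indecomposable]: a union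
   of two proper subsets of A, one of them empty, is never A. *)
Definition subcontinuum (X : topologicalType) (A : set X) : Prop :=
  compact A /\ connected A.

Definition indecomposable (X : topologicalType) (A : set X) : Prop :=
  ~ exists B C : set X,
      [/\ subcontinuum B, B `<` A, subcontinuum C, C `<` A & A = B `|` C].

Definition hereditarily_indecomposable (X : topologicalType) : Prop :=
  forall A : set X, subcontinuum A -> indecomposable A.

Definition open_cover (X : topologicalType) (U : set (set X)) : Prop :=
  (forall A, U A -> open A) /\ \bigcup_(A in U) A = [set: X].

(* The case j = k forces every member of a chain to be nonempty. *)
Definition chain (X : topologicalType) (n : nat) (O : 'I_n.+1 -> set X) : Prop :=
  open_cover (range O) /\
  forall j k : 'I_n.+1,
    O j `&` O k !=set0 <-> `|(j : nat)%:Z - (k : nat)%:Z| <= 1.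

Definition refines (X : Type) (V U : set (set X)) : Prop :=
  forall A, V A -> exists2 B, U B & A `<=` B.

Definition chainable (X : topologicalType) : Prop :=
  forall U : set (set X), open_cover U ->
    exists (n : nat) (O : 'I_n.+1 -> set X), chain O /\ refines (range O) U.

Definition pseudoarc (R : realType) (X : topologicalType) : Prop :=
  [/\ continuum R X, chainable X, hereditarily_indecomposable X &
      exists x y : X, x <> y].

(* Main.v *)
Require Import Defs.
From mathcomp Require Import all_boot all_order all_algebra.
From mathcomp Require Import all_classical all_reals topology.
From mathcomp Require Import zify.

(** The space X is covered by "chains" of closed sets: weak chains D_0, ..., D_n,
    in which links at distance at least 2 are disjoint.  Two points x, z are
    opposite if no proper subcontinuum contains both; every x has an opposite
    point, since the subcontinua through x that miss a given basic open set are
    nowhere dense, and Baire applies.  We work with chains that start at x and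
    end at z.

    Hereditary indecomposability enters only through the fact that two
    subcontinua that meet are comparable.  Together with the separation of
    components by clopen sets it gives two constructions.
    - Spiral: a fine chain can be rearranged, by repeatedly cutting off the part
      near x and folding it outside, into a fine chain starting at x and ending
      at z.
    - Fold (Krasinkiewicz-Minc): a chain from x to z can be refined along the
      pattern that goes up to j, back to i, and then up to n.
    Every walk from 0 to n in {0, ..., n} is a composite of stutters and such
    folds, so a chain from x to z can be refined along any walk.

    Given opposite pairs (x, z) and (y, w), a fine chain from x to z refining a
    given one does so along some walk, and a chain from y to w can be refined
    along the same walk.  Going back and forth gives two sequences of finer and
    finer chains with the same patterns; matching links with equal indices
    defines in the limit a homeomorphism that sends x to y. *)

Set Implicit Arguments.
Unset Strict Implicit.
Unset Printing Implicit Defensive.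

Import Order.TTheory GRing.Theory Num.Theory.
Local Open Scope classical_set_scope.

(** * Clopen separation in compact Hausdorff spaces *)


Section CompactHausdorff.
Variable X : topologicalType.
Implicit Types A B C E F G U V W : set X.

(** A partition of [E] into relatively clopen pieces, phrased with closed sets of [X] to avoid the
    subspace topology. *)
Definition clopen_split E F G :=
  [/\ closed F, closed G, forall p, F p -> G p -> False
    & forall p, E p <-> F p \/ G p].

Lemma clopen_split_refl E : closed E -> clopen_split E E set0.
Proof.
by move=> cE; split=> //; [exact: closed0|move=> p; split; [left|case]].
Qed.

Lemma clopen_splitI E F G F' G' : clopen_split E F G -> clopen_split E F' G' ->
  clopen_split E (F `&` F') (G `|` G').
Proof.
move=> [cF cG FG EFG] [cF' cG' FG' EFG']; split.
- exact: closedI.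
- exact: closedU.
- by move=> q [Fq F'q] [/(FG q)|/(FG' q)]; exact.
- move=> q; split=> [Eq|[[Fq _]|[Gq|Gq]]].
  + have [Fq|Gq] := (EFG q).1 Eq; last by right; left.
    have [F'q|G'q] := (EFG' q).1 Eq; last by right; right.
    by left.
  + by apply/EFG; left.
  + by apply/EFG; right.
  + by apply/EFG'; right.
Qed.

Lemma connected_cover C F G p q : connected C -> closed F -> closed G ->
  C `<=` F `|` G -> C p -> F p -> C q -> G q -> exists r, [/\ C r, F r & G r].
Proof.
move=> conC cF cG CFG Cp Fp Cq Gq; apply: contrapT => none.
have FGC r : C r -> F r -> G r -> False by move=> *; apply: none; exists r.
suff CF : C = F `&` C by apply: (FGC q) => //; move: Cq; rewrite {1}CF => -[].
apply/esym; rewrite setIC; apply: conC; first by exists p.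
- exists (~` G); first exact: closed_openC.
  rewrite predeqE => r; split=> -[Cr H]; split=> //; first by move=> /FGC; exact.
  by case: (CFG r Cr).
- by exists F.
Qed.

Hypothesis cX : compact [set: X].

(** Otherwise the members of [D] minus [U] generate a proper filter, whose cluster point lies in
    every member but not in [U]. With [U] empty: a directed family of nonempty closed sets has a
    common point. *)
Lemma directed_closed_sub (D : set (set X)) U :
  D !=set0 -> (forall A, D A -> closed A) ->
  (forall A B, D A -> D B -> exists2 C, D C & C `<=` A `&` B) ->
  open U -> (forall p, (forall A, D A -> A p) -> U p) ->
  exists2 A, D A & A `<=` U.
Proof.
move=> [A0 DA0] clD dirD oU DU; apply: contrapT => none.
have PF : ProperFilter (filter_from D (fun A => A `\` U)).
  apply: filter_from_proper.
    apply: filter_from_filter; first by exists A0.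
    move=> A B /dirD h /h[C DC CAB]; exists C => // p [/CAB[Ap Bp] Up].
    by split; split.
  move=> A DA; apply: contrapT => /set0P/negP; rewrite negbK => /eqP AU0.
  apply: none; exists A => //; move=> p Ap; apply: contrapT => Up.
  by have : (A `\` U) p by []; rewrite AU0.
have [|p [_ clp]] := cX PF; first exact: filterT.
have inD A : D A -> A p /\ ~ U p.
  move=> DA.
  have clAU : closed (A `\` U) by apply: closedI; [exact: clD|exact: open_closedC].
  suff: (A `\` U) p by [].
  apply: clAU => B pB; apply: clp => //.
  by exists A.
by have [_] := inD _ DA0; apply; apply: DU => A /inD[].
Qed.

Hypothesis hX : hausdorff_space X.

Lemma closed_point (p : X) : closed [set p].
Proof. exact: accessible_closed_set1 (hausdorff_accessible hX) p. Qed.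

Lemma closed_compact A : closed A -> compact A.
Proof. by move=> cA; apply: (subclosed_compact cA cX). Qed.

Lemma normal_shrink A W : closed A -> open W -> A `<=` W ->
  exists U, [/\ open U, A `<=` U & closure U `<=` W].
Proof.
move=> cA oW AW.
have AnW : set_nbhs A W by apply/set_nbhsP; exists W; split.
have [C /set_nbhsP[U [oU AU UC]] CW] := compact_normal hX cX cA AnW.
by exists U; split=> //; apply: subset_trans CW; exact: closure_subset.
Qed.

Lemma normal_separation A B : closed A -> closed B ->
  (forall p, A p -> B p -> False) ->
  exists U V, [/\ open U, open V, A `<=` U, B `<=` V &
    forall p, U p -> V p -> False].
Proof.
move=> cA cB AB.
have [||U [oU AU UB]] := @normal_shrink A (~` B) cA.
- exact: closed_openC.
- by move=> p /AB.
exists U, (~` closure U); split=> //.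
- exact/closed_openC/closed_closure.
- by move=> p Bp /UB.
- by move=> p /subset_closure.
Qed.

(* In a compact Hausdorff space, quasi-components are components. *)
Lemma clopen_cut E A (p : X) : closed E -> closed A -> E p ->
  (forall C, connected C -> C `<=` E -> C p -> forall q, C q -> A q -> False) ->
  exists F G, [/\ clopen_split E F G, F p & forall q, F q -> A q -> False].
Proof.
move=> cE cA Ep sep.
pose D := [set F | exists2 G, clopen_split E F G & F p].
pose Q := [set q | forall F, D F -> F q].
have D0 : D !=set0.
  by exists E; exists set0 => //; exact: clopen_split_refl.
have clD F : D F -> closed F by case=> G [].
have dirD F F' : D F -> D F' -> exists2 C, D C & C `<=` F `&` F'.
  move=> [G sp Fp] [G' sp' F'p].
  by exists (F `&` F') => //; exists (G `|` G') => //; exact: clopen_splitI.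
have clQ : closed Q.
  have -> : Q = \bigcap_(F in D) F by rewrite predeqE => q; split=> h F /h.
  exact: closed_bigI.
have Qp : Q p by move=> F [].
have QE : Q `<=` E.
  by move=> q; apply; exists set0 => //; exact: clopen_split_refl.
(* If [U] and [V] separate [Q1] from [Q2], some [F] in [D] lies in their union. Removing [V] from
   [F] leaves a member of [D], so [Q] misses [Q2]. *)
have half Q1 Q2 : closed Q1 -> closed Q2 -> (forall q, Q1 q -> Q2 q -> False) ->
    (forall q, Q q -> Q1 q \/ Q2 q) -> Q1 p -> forall q, Q2 q -> Q q -> False.
  move=> c1 c2 Q12 QQ Q1p q Q2q Qq.
  have [U [V [oU oV QU QV UV]]] := normal_separation c1 c2 Q12.
  have [||F [G [cF cG FG EFG] Fp] FUV] := @directed_closed_sub D (U `|` V) D0 clD dirD.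
  - exact: openU.
  - by move=> r /QQ[/QU|/QV]; [left|right].
  have : (F `\` V) q.
    apply: Qq; exists (G `|` (F `\` U)) => //; last first.
      by split=> //; move: (QU _ Q1p) => Up /(UV _ Up).
    split.
    - by apply: closedI => //; apply: open_closedC.
    - by apply: closedU => //; apply: closedI => //; exact: open_closedC.
    - move=> r [Fr Vr] [/(FG r)|[_ Ur]]; first exact.
      by have [] := FUV _ Fr.
    - move=> r; rewrite EFG; split=> [[Fr|Gr]|[[Fr _]|[Gr|[Fr _]]]]; try by [left|right].
      + have [Vr|Vr] := pselect (V r); last by left.
        by right; right; split=> // /UV; apply.
      + by right; left.
  by case=> _; apply; apply: QV.
have conQ : connected Q.
  move=> B [b Bb] [O oO BO] [K cK BK].
  have cB : closed B by rewrite BK; exact: closedI.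
  have cQB : closed (Q `&` ~` O) by apply: closedI => //; exact: open_closedC.
  have cov q : Q q -> B q \/ (Q `&` ~` O) q.
    by move=> Qq; have [Oq|Oq] := pselect (O q); [left; rewrite BO|right].
  have dis q : B q -> (Q `&` ~` O) q -> False by rewrite BO => -[_ Oq] [_].
  have [Bp|QBp] := cov p Qp.
    rewrite predeqE => q; split; first by rewrite BO => -[].
    move=> Qq; have [//|QBq] := cov q Qq.
    by have := half _ _ cB cQB dis cov Bp q QBq Qq.
  have Qb : Q b by move: Bb; rewrite BO => -[].
  have := half _ _ cQB cB (fun q h1 h2 => dis q h2 h1) _ QBp b Bb Qb.
  by case=> q /cov [|]; [right|left].
have [||F [G sp Fp] FA] := @directed_closed_sub D (~` A) D0 clD dirD.
- exact: closed_openC.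
- by move=> q Qq Aq; exact: (sep Q conQ QE Qp q Qq Aq).
by exists F, G; split=> // q /FA.
Qed.

(** The intersections of a clopen neighbourhood of [A] in [E] with one of [A'] in [E'] form a
    directed family. A point common to all would be joined to [A] within [E] and to [A'] within
    [E'], so by compactness one intersection is empty. *)
Lemma clopen_double_cut E E' A A' : closed E -> closed E' -> closed A ->
  closed A' -> A `<=` E -> A' `<=` E' ->
  (forall C C' p a a', connected C -> connected C' -> C `<=` E -> C' `<=` E' ->
    C p -> C' p -> C a -> A a -> C' a' -> A' a' -> False) ->
  exists F G F' G', [/\ clopen_split E F G, clopen_split E' F' G',
    A `<=` F, A' `<=` F' & forall p, F p -> F' p -> False].
Proof.
move=> cE cE' cA cA' AE AE' sep.
pose D1 E A F := exists2 G, clopen_split E F G & A `<=` F.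
pose D := [set H | exists F F', [/\ D1 E A F, D1 E' A' F' & H = F `&` F']].
have D1I E1 A1 F F' : D1 E1 A1 F -> D1 E1 A1 F' -> D1 E1 A1 (F `&` F').
  move=> [G sp AF] [G' sp' AF']; exists (G `|` G'); first exact: clopen_splitI.
  by move=> p Ap; split; [exact: AF|exact: AF'].
have D1E E1 A1 : closed E1 -> A1 `<=` E1 -> D1 E1 A1 E1.
  by exists set0 => //; exact: clopen_split_refl.
(* If nothing connected joins [p] to [A1] in [E1], a cut around [p] leaves a complementary piece
   containing [A1] but not [p]. *)
have meets E1 A1 p : closed E1 -> closed A1 -> A1 `<=` E1 ->
    (forall F, D1 E1 A1 F -> F p) ->
    exists C a, [/\ connected C, C `<=` E1, C p, C a & A1 a].
  move=> cE1 cA1 AE1 Dp; apply: contrapT => none.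
  have [||F [G [[cF cG FG EFG] Fp FA]]] := @clopen_cut E1 A1 p cE1 cA1.
  - by apply: Dp; exact: D1E.
  - by move=> C conC CE Cp q Cq Aq; apply: none; exists C, q.
  apply: (FG p) => //; apply: Dp; exists F.
    split=> // q; first by move=> /[swap]; exact: FG.
    by rewrite EFG; tauto.
  by move=> q Aq; have [/FA|] := (EFG q).1 (AE1 _ Aq).
have [|||||H [F [F' [[G sp AF] [G' sp' AF'] ->]]] H0] := @directed_closed_sub D set0.
- by exists (E `&` E'); exists E, E'; split=> //; exact: D1E.
- by move=> _ [F [F' [[G [? _ _ _] _] [G' [? _ _ _] _] ->]]]; exact: closedI.
- move=> _ _ [F [F' [DF DF' ->]]] [K [K' [DK DK' ->]]].
  exists ((F `&` K) `&` (F' `&` K')).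
    by exists (F `&` K), (F' `&` K'); split=> //; exact: D1I.
  by move=> p [[? ?] [? ?]].
- exact: open0.
- move=> p Dp.
  have [||||C [a [conC CE Cp Ca Aa]]] := meets E A p => //.
    by move=> F DF; have [] : (F `&` E') p by apply: Dp; exists F, E'; split=> //; exact: D1E.
  have [||||C' [a' [conC' CE' C'p Ca' Aa']]] := meets E' A' p => //.
    by move=> F DF; have [] : (E `&` F) p by apply: Dp; exists E, F; split=> //; exact: D1E.
  exact: (sep C C' p a a').
by exists F, G, F', G'; split=> // p Fp F'p; exact: (H0 p).
Qed.

End CompactHausdorff.

(** * Subcontinua and opposite points *)


Section Continuum.
Variable X : topologicalType.
Hypothesis cX : compact [set: X].
Hypothesis hX : hausdorff_space X.

(** Nonempty open sets are chosen in turn, the closure of each inside the previous one minus [T k];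
    by compactness the closures share a point. *)
Lemma baire_compact (T : nat -> set X) (p0 : X) : (forall k, closed (T k)) ->
  (forall k W, open W -> W `<=` T k -> W = set0) -> exists z, forall k, ~ T k z.
Proof.
move=> clT ndT.
have step (kV : nat * set X) : exists V', open kV.2 -> kV.2 !=set0 ->
    [/\ open V', V' !=set0 & closure V' `<=` kV.2 `\` T kV.1].
  have [oV|] := pselect (open kV.2); last by exists set0.
  have [[q Vq]|] := pselect (kV.2 !=set0); last by exists set0.
  have [p [Vp Tp]] : (kV.2 `\` T kV.1) !=set0.
    apply: contrapT => /nonemptyPn V0.
    have /(ndT _ _ oV) V00 : kV.2 `<=` T kV.1.
      move=> r Vr; apply: contrapT => Tr.
      by have : (kV.2 `\` T kV.1) r by []; rewrite V0.
    by rewrite V00 in Vq.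
  have [|||U [oU pU UV]] := @normal_shrink X cX hX [set p] (kV.2 `\` T kV.1).
  - exact: closed_point.
  - by apply: openI => //; exact: closed_openC.
  - by move=> _ ->.
  by exists U => _ _; split=> //; exists p; apply: pU.
have [g gP] := choice step.
pose fix v k := if k is k'.+1 then g (k', v k') else [set: X].
have vP k : open (v k) /\ v k !=set0.
  elim: k => [|k [oV V0]] /=; first by split; [exact: openT|exists p0].
  by have [] := gP (k, v k) oV V0.
have vS k : closure (v k.+1) `<=` v k `\` T k.
  by have [oV V0] := vP k; have [] := gP (k, v k) oV V0.
have vmono i j : (i <= j)%N -> closure (v j) `<=` closure (v i).
  elim: j => [|j IH]; first by rewrite leqn0 => /eqP ->.
  rewrite leq_eqVlt => /orP[/eqP ->//|]; rewrite ltnS => /IH ij.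
  apply: subset_trans ij; apply: subset_trans (@subset_closure _ (v j)).
  by move=> p /vS[].
pose D := [set C | exists k, C = closure (v k)].
have [[z zD]|zP] := pselect (exists z, forall A, D A -> A z).
  exists z => k Tz.
  have /vS[_]// : closure (v k.+1) z by apply: zD; exists k.+1.
have [|||||A [k ->] A0] := @directed_closed_sub X cX D set0.
- by exists (closure (v 0)); exists 0.
- by move=> _ [k ->]; exact: closed_closure.
- move=> _ _ [i ->] [j ->]; exists (closure (v (maxn i j))); first by exists (maxn i j).
  by move=> p vp; split; apply: vmono vp; rewrite ?leq_maxl ?leq_maxr.
- exact: open0.
- by move=> p h; apply: zP; exists p.
by have [_ [q /subset_closure /A0]] := vP k.
Qed.

Hypothesis hi : hereditarily_indecomposable X.

(** Otherwise the union of [Y] and [Z] is a subcontinuum decomposed into two proper ones. *)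
Lemma subcontinuum_comparable (Y Z : set X) p :
  subcontinuum Y -> subcontinuum Z -> Y p -> Z p -> Y `<=` Z \/ Z `<=` Y.
Proof.
move=> sY sZ Yp Zp.
have sYZ : subcontinuum (Y `|` Z).
  split; first by apply: compactU; [case: sY|case: sZ].
  by apply: connectedU; [exists p|case: sY|case: sZ].
apply: contrapT => /not_orP[YZ ZY]; apply: (hi sYZ); exists Y, Z; split=> //.
- by split; [left|move=> h; apply: ZY => q Zq; apply: h; right].
- by split; [right|move=> h; apply: YZ => q Yq; apply: h; left].
Qed.

Lemma closure_minimal (A F : set X) : closed F -> A `<=` F -> closure A `<=` F.
Proof.
by move=> cF AF; rewrite [X in _ `<=` X](closure_id F).1 //; exact: closure_subset.
Qed.

Lemma closure_subcontinuum (C : set X) : connected C -> subcontinuum (closure C).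
Proof.
by move=> conC; split; [apply: closed_compact => //; exact: closed_closure
  |exact: connected_closure].
Qed.

(** The closures of [C] and [C'] are subcontinua that stay inside [E] and [E'], so they can be
    compared instead. *)
Lemma connected_comparable (E E' C C' : set X) p : closed E -> closed E' ->
  connected C -> connected C' -> C `<=` E -> C' `<=` E' -> C p -> C' p ->
  C `<=` E' \/ C' `<=` E.
Proof.
move=> cE cE' conC conC' CE CE' Cp C'p.
have [||h|h] := @subcontinuum_comparable (closure C) (closure C') p
  (closure_subcontinuum conC) (closure_subcontinuum conC').
- exact: subset_closure.
- exact: subset_closure.
- by left=> q /subset_closure /h; exact: closure_minimal.
- by right=> q /subset_closure /h; exact: closure_minimal.
Qed.

Hypothesis conX : connected [set: X].

(** A connected set through [q] off a nonempty [W] cannot meet [P]: neither would contain the other.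
    So a clopen piece of the complement of [W] surrounds [q] and misses [P]; it is then clopen in
    [X], against connectedness. *)
Lemma subcontinuum_nowhere_dense (P W : set X) q : subcontinuum P -> ~ P q ->
  open W -> W `<=` P -> W = set0.
Proof.
move=> sP Pq oW WP; rewrite -subset0 => w Ww.
have cP : closed P by apply: compact_closed => //; case: sP.
have cE : closed (~` W) by exact: open_closedC.
have [||C conC CE Cq r Cr [Pr Wr]|F [G [[cF cG FG EFG] Fq FA]]] :=
  @clopen_cut X cX hX (~` W) (P `&` ~` W) q cE.
- exact: closedI.
- by move=> /WP.
- have [||CP|PE] := @connected_comparable (~` W) P C P r cE cP conC _ CE _ Cr Pr => //.
  + by case: sP.
  + exact: Pq (CP _ Cq).
  + exact: PE (WP _ Ww) Ww.
have [||||||r [_ Fr [Pr|Gr]]] := @connected_cover X [set: X] F (P `|` G) q w conX cF => //.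
- exact: closedU.
- move=> r _; have [Wr|Wr] := pselect (W r); first by right; left; exact: WP.
  by have [|] := (EFG r).1 Wr; [left|right; right].
- by left; apply: WP.
- by apply: (FA r) => //; split=> //; exact: (EFG r).2 (or_introl Fr).
- exact: FG Fr Gr.
Qed.

(* The composant of x is a countable union of proper subcontinua. *)
Lemma opposite_point (B : nat -> set X) (x : X) :
  (forall i, open (B i) /\ B i !=set0) ->
  (forall q W, open W -> W q -> exists i, B i `<=` W) ->
  exists z, forall K : set X, subcontinuum K -> K x -> K z -> K = setT.
Proof.
move=> oB baseB.
have cC i : closed (connected_component (~` B i) x).
  by apply: component_closed; apply: open_closedC; case: (oB i).
have [||z zP] := @baire_compact (fun i => connected_component (~` B i) x) x.
- exact: cC.
- move=> i W oW; have [_ [b Bb]] := oB i.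
  apply: (subcontinuum_nowhere_dense (q := b)) => //.
    by split; [exact: closed_compact|exact: component_connected].
  by move=> /connected_component_sub.
(* A subcontinuum that omits a point misses some [B i], hence lies in the component of [x] off
   [B i], which [z] avoids. *)
exists z => K [compK conK] Kx Kz.
apply/seteqP; split=> // q _; apply: contrapT => Kq.
have [||i BK] := baseB q (~` K) => //.
  by apply: closed_openC; exact: compact_closed.
apply: (zP i); apply: connected_component_max Kz => //.
by move=> r Kr /BK.
Qed.

End Continuum.

(** * Stutters and folds of chains *)


(* Links of index above n are empty, so that a chain is a function on nat; links
   may also be empty below n, and consecutive links need not meet. *)
Definition weak_chain (X : Type) (n : nat) (D : nat -> set X) :=
  [/\ forall s p, D s p -> s <= n, forall p, exists s, D s p
    & forall s t p, D s p -> D t p -> s <= t.+1].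

Definition ends (X : Type) (x z : X) (n : nat) (D : nat -> set X) :=
  [/\ D 0 x, forall s, D s x -> s = 0, D n z & forall s, D s z -> s = n].

Definition links (X : Type) (D : nat -> set X) (P : nat -> Prop) :=
  [set p | exists2 s, P s & D s p].

(* 0, ..., j, then back to i, then up again. *)
Definition fold_map (i j s : nat) :=
  if s <= j then s else if s <= j + (j - i) then j + j - s else s - (j - i).*2.

(** New chains are written as unions of pieces, each switched on by a condition on the index; this
    keeps their links closed. *)
Lemma closed_guard (X : topologicalType) (P : Prop) (A : set X) :
  closed A -> closed [set p | P /\ A p].
Proof.
move=> cA; have [HP|nP] := pselect P.
  by rewrite (_ : [set p | _] = A) // predeqE => p; split=> [[]|].
by rewrite (_ : [set p | _] = set0); [exact: closed0|rewrite predeqE => p; split=> // -[]].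
Qed.

Lemma closed_links (X : topologicalType) n (D : nat -> set X) P :
  (forall s, closed (D s)) -> (forall s p, D s p -> s <= n) -> closed (links D P).
Proof.
move=> cD Dn.
rewrite (_ : links D P = \bigcup_(s in [set s | s < n.+1]) [set p | P s /\ D s p]).
  apply: closed_bigcup; first exact: finite_II.
  by move=> s _; exact: closed_guard.
rewrite predeqE => p; split=> [[s Ps Ds]|[s _ [Ps Ds]]]; last by exists s.
by exists s => //=; rewrite ltnS; exact: Dn Ds.
Qed.

Section Fold.
Variable X : topologicalType.
Hypothesis cX : compact [set: X].
Hypothesis hX : hausdorff_space X.
Variables x z : X.
Hypothesis xz : x <> z.

Definition closed_chain n (D : nat -> set X) :=
  [/\ forall s, closed (D s), weak_chain n D & ends x z n D].

(** Link [i] is cut into two overlapping halves by disjoint open sets, one around [x] and the lower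
    links, the other around [z] and the higher links. *)
Lemma stutter_chain n D i : closed_chain n D -> i <= n ->
  exists2 D', closed_chain n.+1 D' &
    forall s, D' s `<=` D (if s <= i then s else s.-1).
Proof.
move=> [cD [Dn covD adjD] [D0x xD Dnz zD]] le_in.
have [|||U [V [oU oV AU BV UV]]] := @normal_separation X cX hX
  (links D (fun s => s < i) `|` [set x]) (links D (fun s => i < s) `|` [set z]).
- by apply: closedU; [exact: (closed_links cD Dn)|exact: closed_point].
- by apply: closedU; [exact: (closed_links cD Dn)|exact: closed_point].
- move=> p [[s si Ds]|->] [[t ti Dt]|pz].
  + by have := adjD _ _ _ Dt Ds; lia.
  + by move: Ds; rewrite pz => /zD; lia.
  + by move/xD: Dt ti => ->.
  + exact: xz.
have Ux : U x by apply: AU; right.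
have Vz : V z by apply: BV; right.
have Ulow s p : D s p -> s < i -> U p by move=> Ds si; apply: AU; left; exists s.
have Vhigh s p : D s p -> i < s -> V p by move=> Ds si; apply: BV; left; exists s.
exists (fun s => [set p | s < i /\ D s p] `|` [set p | s = i /\ (D i `\` V) p] `|`
  [set p | s = i.+1 /\ (D i `\` U) p] `|` [set p | i.+1 < s /\ D s.-1 p]); last first.
  move=> s p [[[[si Ds]|[-> [Di _]]]|[-> [Di _]]]|[si Ds]].
  - by rewrite (ltnW si).
  - by rewrite leqnn.
  - by rewrite ltnn.
  - by rewrite leqNgt (ltnW si).
split.
- move=> s; repeat apply: closedU; apply: closed_guard => //;
    by apply: closedI => //; exact: open_closedC.
- split.
  + move=> s p [[[[si /Dn]|[-> [/Dn]]]|[-> [/Dn]]]|[si /Dn]]; lia.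
  + move=> p; have [t Dt] := covD p.
    have [ti|ti|ti] := ltngtP t i.
    * by exists t; left; left; left.
    * by exists t.+1; right; split.
    * have [Vp|Vp] := pselect (V p); last by exists i; left; left; right; rewrite -ti.
      by exists i.+1; left; right; split=> //; split; [rewrite -ti|move=> /UV; exact].
  + move=> s t p [[[[si Ds]|[-> [Ds Ns]]]|[-> [Ds Ns]]]|[si Ds]]
      [[[[ti Dt]|[-> [Dt Nt]]]|[-> [Dt Nt]]]|[ti Dt]] //; try lia;
    try (by have := adjD _ _ _ Ds Dt; lia).
    * by case: Ns; exact: Ulow Dt ti.
    * by case: Nt; apply: Vhigh Ds _; lia.
- split.
  + have [->|i0] := posnP i; first by left; left; right; split=> //; split=> // /(UV _ Ux).
    by left; left; left.
  + move=> s [[[[_ /xD]|[-> [/xD]]]|[_ [_]]]|[si /xD]] //; lia.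
  + have [->|i0] := eqVneq i n; first by left; right; split=> //; split=> // /UV; exact.
    by right; split=> //; lia.
  + move=> s [[[[si /zD]|[_ [_]]]|[-> [/zD -> _]]]|[si /zD]] //; lia.
Qed.

Hypothesis hi : hereditarily_indecomposable X.

(* A component of D_0 + ... + D_(j-1) that meets D_0 + ... + D_(i-1) and a component
   of D_(i+1) + ... + D_n that meets D_(j+1) + ... + D_n are disjoint, since they are
   not comparable; F and F' are disjoint clopen neighbourhoods of them. *)
Lemma fold_chain n D i j : closed_chain n D -> i < j -> j <= n ->
  exists2 D', closed_chain (n + (j - i).*2) D' &
    forall s, D' s `<=` D (fold_map i j s).
Proof.
move=> [cD [Dn covD adjD] [D0x xD Dnz zD]] ij jn.
pose E := links D (fun s => s < j); pose E' := links D (fun s => i < s).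
have [|||||||F [G [F' [G' [[cF cG FG EFG] [cF' cG' FG' EFG'] AF AF' FF']]]]] :=
  @clopen_double_cut X cX hX E E'
  (links D (fun s => s < i) `|` [set x]) (links D (fun s => j < s) `|` [set z]).
- exact: (closed_links cD Dn).
- exact: (closed_links cD Dn).
- by apply: closedU; [exact: (closed_links cD Dn)|exact: closed_point].
- by apply: closedU; [exact: (closed_links cD Dn)|exact: closed_point].
- by move=> p [[s si Ds]|->]; [exists s => //; lia|exists 0 => //; lia].
- by move=> p [[s si Ds]|->]; [exists s => //; lia|exists n => //; lia].
- move=> C C' p a a' conC conC' CE CE' Cp C'p Ca Aa C'a' Aa'.
  have cE : closed E by exact: (closed_links cD Dn).
  have cE' : closed E' by exact: (closed_links cD Dn).
  have [/(_ _ Ca)[t it Dt]|/(_ _ C'a')[t tj Dt]] :=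
    connected_comparable cX hi cE cE' conC conC' CE CE' Cp C'p.
  + case: Aa => [[u ui Du]|ax]; first by have := adjD _ _ _ Dt Du; lia.
    by move: Dt; rewrite ax => /xD; lia.
  + case: Aa' => [[u uj Du]|az]; first by have := adjD _ _ _ Du Dt; lia.
    by move: Dt; rewrite az => /zD; lia.
have Fx : F x by apply: AF; right.
have F'z : F' z by apply: AF'; right.
have Flow s p : D s p -> s < i -> F p by move=> Ds si; apply: AF; left; exists s.
have F'high s p : D s p -> j < s -> F' p by move=> Ds sj; apply: AF'; left; exists s.
have FGE s p : D s p -> s < j -> F p \/ G p by move=> Ds sj; apply/EFG; exists s.
have FGE' s p : D s p -> i < s -> F' p \/ G' p by move=> Ds si; apply/EFG'; exists s.
(* Strictly between links [i] and [j], each point goes to the first ascent ([F]), the descent ([G]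
   and [G']) or the last ascent ([F']). Link [j] is divided by [F'] and [G'] alone, link [i] by [F]
   and [G] alone. *)
exists (fun s => [set p | s < j /\ (D s `&` F) p] `|`
  [set p | s = j /\ (D j `&` G') p] `|`
  [set p | j < s < j + (j - i) /\ (D (j + j - s) `&` (G `&` G')) p] `|`
  [set p | s = j + (j - i) /\ (D i `&` G) p] `|`
  [set p | j + (j - i) < s /\ (D (s - (j - i).*2) `&` F') p]); last first.
  move=> s p; rewrite /fold_map.
  move=> [[[[[sj [Ds _]]|[-> [Dj _]]]|[sji [Ds _]]]|[-> [Di _]]]|[sj [Ds _]]].
  - by rewrite (ltnW sj).
  - by rewrite leqnn.
  - have -> : (s <= j) = false by lia.
    by have -> : (s <= j + (j - i)) by lia.
  - have -> : (j + (j - i) <= j) = false by lia.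
    by rewrite leqnn; have -> : j + j - (j + (j - i)) = i by lia.
  - have -> : (s <= j) = false by lia.
    by have -> : (s <= j + (j - i)) = false by lia.
split.
- by move=> s; repeat apply: closedU; apply: closed_guard; repeat apply: closedI.
- split.
  + move=> s p [[[[[sj [/Dn Ds _]]|[-> [/Dn Dj _]]]|[sji [/Dn Ds _]]]|[-> [/Dn Di _]]]|[sj [/Dn Ds _]]]; lia.
  + move=> p; have [t Dt] := covD p.
    have [ti|ti] := ltnP t i.
      by exists t; left; left; left; left; split; [lia|split=> //; exact: Flow Dt ti].
    have [tj|tj] := ltnP j t.
      exists (t + (j - i).*2); right; split; first by lia.
      by rewrite addnK; split=> //; exact: F'high Dt tj.
    case: (eqVneq t j) Dt => [->|tnj] Dt.
      have [F'p|G'p] := FGE' _ _ Dt ij.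
        by exists (j + (j - i).*2); right; split; [lia|rewrite addnK; split].
      by exists j; left; left; left; right; split.
    have tj' : t < j by lia.
    have [Fp|Gp] := FGE _ _ Dt tj'; first by exists t; left; left; left; left; split.
    have [tei|tni] := eqVneq t i.
      by exists (j + (j - i)); left; right; split=> //; split=> //; rewrite -tei.
    have ti' : i < t by lia.
    have [F'p|G'p] := FGE' _ _ Dt ti'.
      by exists (t + (j - i).*2); right; split; [lia|rewrite addnK; split].
    exists (j + j - t); left; left; right; split; first by lia.
    by have -> : j + j - (j + j - t) = t by lia.
  + move=> s t p.
    have nFG := FG p; have nFG' := FG' p; have nFF' := FF' p.
    move=> [[[[[sj [Ds Fs]]|[-> [Ds Fs]]]|[sji [Ds [Fs Fs']]]]|[-> [Ds Fs]]]|[sj [Ds Fs]]]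
      [[[[[tj [Dt Ft]]|[-> [Dt Ft]]]|[tji [Dt [Ft Ft']]]]|[-> [Dt Ft]]]|[tj [Dt Ft]]];
      try (by exfalso; tauto); try lia;
      by have := adjD _ _ _ Ds Dt; have := adjD _ _ _ Dt Ds; lia.
- split.
  + by left; left; left; left; split; [lia|].
  + move=> s [[[[[sj [/xD]]|[-> [/xD]]]|[sji [/xD]]]|[-> [_ /(FG _ Fx)]]]|[sj [/xD]]] //; lia.
  + by right; split; [lia|rewrite addnK].
  + move=> s [[[[[sj [/zD]]|[-> [_ /(FG' _ F'z)]]]|[sji [/zD]]]|[-> [/zD]]]|[sj [/zD]]] //; lia.
Qed.

End Fold.

(** * Refining a chain along a walk *)


Definition walk m n (w : nat -> nat) :=
  [/\ w 0 = 0, w m = n,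
    forall s, s < m -> w s.+1 <= (w s).+1 /\ w s <= (w s.+1).+1
    & forall s, s <= m -> w s <= n].

Section Zigzag.
Variables (m n : nat) (w : nat -> nat).
Hypothesis walkw : walk m n w.
Hypothesis no_stutter : forall s, s < m -> w s <> w s.+1.

Let turn s := (0 < s < m) /\ w s.-1 = w s.+1.

Let walk_step s : s < m -> w s.+1 = (w s).+1 \/ w s = (w s.+1).+1.
Proof.
by move=> sm; case: walkw => _ _ /(_ s sm)[] ? ? _; have := no_stutter sm; lia.
Qed.

(** Both arms leave [c] in the same direction and, with no further turn closer than [r], keep it.
    The sum of truncated differences is the distance from [s] to [c]. *)
Lemma walk_reflect c r : turn c -> r <= c -> c + r <= m ->
  (forall s, turn s -> s = c \/ r <= s - c + (c - s)) ->
  forall t, t <= r -> w (c + t) = w (c - t).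
Proof.
move=> [c0m wc] rc cr noturn.
(* Two consecutive values are carried along, since they determine the direction of the next step. *)
suff H t : (t <= r -> w (c + t) = w (c - t)) /\ (t < r -> w (c + t.+1) = w (c - t.+1)).
  by move=> t tr; have [] := H t; auto.
elim: t => [|t [IH1 IH2]].
  by split=> _; rewrite ?addn0 ?subn0 // addn1 subn1.
split=> // tr.
have e1 : w (c + t) = w (c - t) by apply: IH1; lia.
have e2 : w (c + t.+1) = w (c - t.+1) by apply: IH2; lia.
have n1 : w (c + t) <> w (c + t.+2).
  rewrite !addnS => e; have [||] := noturn (c + t).+1; [|lia|lia].
  by split; [lia|].
have n2 : w (c - t.+2) <> w (c - t).
  move=> e; have [||] := noturn (c - t.+1); [|lia|lia].
  split; first by lia.
  have -> : (c - t.+1).-1 = c - t.+2 by lia.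
  by have -> : (c - t.+1).+1 = c - t by lia.
have f1 : w (c + t.+1) = (w (c + t)).+1 \/ w (c + t) = (w (c + t.+1)).+1.
  by rewrite addnS; apply: walk_step; lia.
have f2 : w (c + t.+2) = (w (c + t.+1)).+1 \/ w (c + t.+1) = (w (c + t.+2)).+1.
  by rewrite [c + t.+2]addnS; apply: walk_step; lia.
have f3 : w (c - t) = (w (c - t.+1)).+1 \/ w (c - t.+1) = (w (c - t)).+1.
  (have -> : c - t = (c - t.+1).+1 by lia); apply: walk_step; lia.
have f4 : w (c - t.+1) = (w (c - t.+2)).+1 \/ w (c - t.+2) = (w (c - t.+1)).+1.
  (have -> : c - t.+1 = (c - t.+2).+1 by lia); apply: walk_step; lia.
lia.
Qed.

(* The closest pair of turning points of the walk yields a zigzag. *)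
Lemma zigzag_of_turns c l : turn c -> turn (c + l) -> 0 < l ->
  exists c l, [/\ 0 < l, l <= c, c + l.*2 <= m,
    forall t, t <= l -> w (c + t) = w (c - t)
    & forall t, t <= l -> w (c + l + t) = w (c + l - t)].
Proof.
elim/ltn_ind: l c => l IH c tc tcl l0.
have [[c1 [l1 [l1l l10 tc1 tcl1]]]|minl] :=
  pselect (exists c1 l1, [/\ l1 < l, 0 < l1, turn c1 & turn (c1 + l1)]).
  exact: (IH l1 l1l c1).
have noturn s s' : turn s -> turn s' -> s = s' \/ l <= s - s' + (s' - s).
  move=> ts ts'; have [->|ss'] := eqVneq s s'; first by left.
  right; rewrite leqNgt; apply/negP => sl; apply: minl.
  exists (minn s s'), (s - s' + (s' - s)); split; [done|lia| |].
    by case: leqP.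
  case: leqP => ?.
    by have -> : s + (s - s' + (s' - s)) = s' by lia.
  by have -> : s' + (s - s' + (s' - s)) = s by lia.
have [w0 wm _ wle] := walkw.
have c0 : 0 < c < m by case: tc.
have clm : 0 < c + l < m by case: tcl.
(* If [c < l], reflection at [c] takes the value 0 to time [c + c], which must be a turn since the
   walk cannot go below 0; it is too close to [c]. *)
have [lc|cl] := leqP l c; last first.
  have refl : w (c + c) = w (c - c).
    apply: (walk_reflect (r := c)) => //; first by lia.
    by move=> s /noturn/(_ tc); lia.
  rewrite subnn w0 in refl.
  have [||] := @noturn (c + c) c _ tc; [|lia|lia].
  split; first by lia.
  have := @walk_step (c + c); have := @walk_step (c + c).-1.
  have -> : (c + c).-1.+1 = c + c by lia.
  by rewrite refl; lia.
have [cllm|mcll] := leqP (c + l.*2) m.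
  exists c, l; split=> //.
    apply: walk_reflect => //; first by lia.
    by move=> s ts; exact: noturn.
  apply: walk_reflect => //; [lia|lia|].
  by move=> s ts; exact: noturn.
(* Likewise at the other end: the maximum [n], reflected at [c + l], would give a turn closer than
   [l]. *)
pose r := m - (c + l).
have refl : w (c + l + r) = w (c + l - r).
  apply: (walk_reflect (r := r)) => //; [rewrite /r; lia|rewrite /r; lia|].
  by move=> s /noturn/(_ tcl); rewrite /r; lia.
have e : c + l + r = m by rewrite /r; lia.
rewrite e wm in refl.
have [||] := @noturn (c + l - r) (c + l) _ tcl; [|rewrite /r; lia|rewrite /r; lia].
split; first by rewrite /r; lia.
have := @walk_step (c + l - r); have := @walk_step (c + l - r).-1.
have := wle (c + l - r).-1; have := wle (c + l - r).+1.
have -> : (c + l - r).-1.+1 = c + l - r by rewrite /r; lia.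
by rewrite -refl /r; lia.
Qed.

(** The first departure from the identity is a step down, right after a turn. Without a later turn
    the walk would descend to its end, finishing below a value already reached, whereas it ends at
    its maximum [n]. *)
Lemma walk_zigzag : (exists2 s, s <= m & w s <> s) ->
  exists c l, [/\ 0 < l, l <= c, c + l.*2 <= m,
    forall t, t <= l -> w (c + t) = w (c - t)
    & forall t, t <= l -> w (c + l + t) = w (c + l - t)].
Proof.
have [w0 wm _ wle] := walkw.
move=> [s sm ws].
have exP : exists s, (s <= m) && (w s != s) by exists s; rewrite sm; apply/eqP.
case: (ex_minnP exP) => s1 /andP[s1m /eqP ws1] mins1.
have low t : t < s1 -> w t = t.
  move=> ts1; apply/eqP/negP => /negP wt.
  by have := mins1 t; rewrite wt andbT; lia.
have s1gt1 : 1 < s1.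
  case: s1 s1m ws1 {mins1 low} => [|[|//]] s1m; first by rewrite w0.
  by have := @walk_step 0 s1m; lia.
have l1 : w s1.-1 = s1.-1 by apply: low; lia.
have l2 : w s1.-2 = s1.-2 by apply: low; lia.
have ws1' : w s1 = s1.-2.
  have := @walk_step s1.-1; rewrite prednK; last by lia.
  by rewrite l1; lia.
have tc : turn s1.-1.
  by split; [lia|rewrite prednK ?l2 //; lia].
have [[l [l0 tcl]]|none] := pselect (exists l, 0 < l /\ turn (s1.-1 + l)).
  exact: zigzag_of_turns tc tcl l0.
have desc t : s1 + t <= m -> w (s1 + t) + t = s1.-2 /\ w (s1 + t).-1 + t = s1.-1.
  elim: t => [|t IH] st.
    by rewrite !addn0 ws1' l1; lia.
  have [|IH1 IH2] := IH; first by lia.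
  have := @walk_step (s1 + t); have -> : s1 + t.+1 = (s1 + t).+1 by lia.
  rewrite /=.
  have nt : w (s1 + t).-1 <> w (s1 + t).+1.
    move=> e; apply: none; exists t.+1; split=> //.
    have -> : s1.-1 + t.+1 = s1 + t by lia.
    by split=> //; lia.
  lia.
have := desc (m - s1); have -> : s1 + (m - s1) = m by lia.
have := wle s1.-1; rewrite wm l1; lia.
Qed.

End Zigzag.

Section Lift.
Variable X : topologicalType.
Hypothesis cX : compact [set: X].
Hypothesis hX : hausdorff_space X.
Hypothesis hi : hereditarily_indecomposable X.
Variables x z : X.
Hypothesis xz : x <> z.

(** A stutter or a zigzag is excised from the walk, the shorter walk is lifted, and a stutter or a
    fold of the chain puts the piece back. A walk with neither is the identity. *)
Lemma lift_walk m n w D : walk m n w -> closed_chain x z n D ->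
  exists2 D', closed_chain x z m D' & forall s, s <= m -> D' s `<=` D (w s).
Proof.
elim/ltn_ind: m w => m IH w walkw chD; have [w0 wm wstep wle] := walkw.
have [[s sm ws]|nostutter] := pselect (exists2 s, s < m & w s = w s.+1).
  case: m IH walkw wm wstep wle sm => // m IH walkw wm wstep wle sm.
  have [|||D1 chD1 D1D] := IH m _ (fun t => if t <= s then w t else w t.+1) => //.
    split.
    - by [].
    - case: ifP => h //; have e : m = s by lia.
      by rewrite -wm e.
    - move=> t tm; case: (ltngtP t s) => ts.
      + by apply: wstep; lia.
      + by apply: wstep; lia.
      + by rewrite ts ws; apply: wstep; lia.
    - by move=> t tm; case: ifP => _; apply: wle; lia.
  have [|D' chD' D'D1] := stutter_chain cX hX xz (i := s) chD1; first by lia.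
  exists D' => // t tm p /D'D1 /D1D.
  case: (leqP t s) => ts h.
    by have := h ltac:(lia); rewrite ts.
  have := h ltac:(lia); case: t tm ts {h} => // t tm ts /=.
  case: (leqP t s) => // st; have -> : t = s by lia.
  by rewrite ws.
have [wid|notid] := pselect (forall s, s <= m -> w s = s).
  have mn : m = n by rewrite -wm wid.
  by rewrite mn; exists D => // s sn; rewrite wid // mn.
have [||c [l [l0 lc clm r1 r2]]] := walk_zigzag walkw.
- by move=> s sm ws; apply: nostutter; exists s.
- by apply: contrapT => h; apply: notid => s sm; apply: contrapT => ws; apply: h; exists s.
(* The two reflections compose to a translation by [l.*2], so the times from [c.+1] to [c + l.*2]
   can be cut out. *)
have r3 t : t <= l -> w (c - l + t) = w (c + l + t).
  move=> tl; rewrite r2 //; have -> : c + l - t = c + (l - t) by lia.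
  by rewrite r1; [congr w; lia|lia].
have [|||D1 chD1 D1D] := IH (m - l.*2) _ (fun t => if t <= c then w t else w (t + l.*2)) => //.
- by lia.
- split.
  + by [].
  + case: ifP => h; last by rewrite subnK //; lia.
    have := r3 l; have -> : c - l + l = c by lia.
    move=> e; have -> : m - l.*2 = c by lia.
    rewrite e // -wm; congr w; lia.
  + move=> t tm; case: (ltngtP t c) => tc.
    * by apply: wstep; lia.
    * by apply: (wstep (t + l.*2)); lia.
    * rewrite tc; have := r3 l; have -> : c - l + l = c by lia.
      move=> -> //; have -> : c.+1 + l.*2 = (c + l + l).+1 by lia.
      apply: wstep; lia.
  + by move=> t tm; case: ifP => _; apply: wle; lia.
have [||D' chD' D'D1] := fold_chain cX hX hi (i := c - l) (j := c) chD1; [lia|lia|].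
have lE : c - (c - l) = l by lia.
rewrite lE in chD'.
exists D'; first by have -> : m = m - l.*2 + l.*2 by lia.
move=> t tm p /D'D1; rewrite /fold_map lE.
case: (leqP t c) => tc.
  by move/D1D => h; have := h ltac:(lia); rewrite tc.
case: (leqP t (c + l)) => tcl.
  move/D1D => h; have := h ltac:(lia).
  have -> : (c + c - t <= c) by lia.
  have -> : w (c + c - t) = w t; last by [].
  have := r1 (t - c); have -> : c + (t - c) = t by lia.
  (have -> : c - (t - c) = c + c - t by lia); move=> -> //; lia.
move/D1D => h; have := h ltac:(lia).
case: (leqP (t - l.*2) c) => tlc; last by rewrite subnK //; lia.
have -> : w (t - l.*2) = w t; last by [].
have := r3 (t - c - l); have -> : c - l + (t - c - l) = t - l.*2 by lia.
(have -> : c + l + (t - c - l) = t by lia); move=> -> //; lia.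
Qed.

End Lift.

(** * Fine chains between opposite points *)


Section Spiral.
Variable X : topologicalType.
Hypothesis cX : compact [set: X].
Hypothesis hX : hausdorff_space X.
Hypothesis hi : hereditarily_indecomposable X.
Variable U : set (set X).
Hypothesis oU : forall V, U V -> open V.

Definition subordinate (D : nat -> set X) :=
  forall s, D s !=set0 -> exists2 V, U V & D s `<=` V.

(* S is a set that has to stay in the last link only. *)
Definition fine_chain (S : set X) n D :=
  [/\ forall s, closed (D s), weak_chain n D, subordinate D
    & forall p, S p -> D n p /\ forall s, D s p -> s = n].

Definition first (x : X) (D : nat -> set X) := D 0 x /\ forall s, D s x -> s = 0.

Variables (x : X) (S : set X).
Hypothesis cS : closed S.
Hypothesis Sx : ~ S x.

(** [x] may also lie in link 1. A small neighbourhood of [x], away from [S] and from links 2 and up,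
    is moved from link 1 to link 0. *)
Lemma fine_chain_first n D : fine_chain S n D -> D 0 x ->
  exists m D', fine_chain S m D' /\ first x D'.
Proof.
move=> [cD [Dn covD adjD] fD SD] D0x.
have [|V UV DV] := fD 0; first by exists x.
have cB : closed (links D (fun s => 1 < s) `|` S).
  by apply: closedU => //; exact: (closed_links cD Dn).
have [|||N [oN xN NV]] := @normal_shrink X cX hX [set x]
  (V `&` ~` (links D (fun s => 1 < s) `|` S)).
- exact: closed_point.
- by apply: openI; [exact: oU|exact: closed_openC].
- move=> _ ->; split; first exact: DV.
  by move=> [[s s1 /adjD/(_ D0x)]|//]; lia.
have Nx : N x by exact: xN.
have NS p : S p -> closure N p -> False by move=> Sp /NV[_]; apply; right.
have N2 s p : D s p -> 1 < s -> closure N p -> False.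
  by move=> Ds s1 /NV[_]; apply; left; exists s.
pose D' s := if s is s'.+1 then (if s' is 0 then D 1 `\` N else D s) else D 0 `|` closure N.
have D'D s p : D' s p -> s = 0 \/ D s p.
  by case: s => [|[|s]] /=; [left|move=> [? _]; right|right].
exists n, D'; split; last first.
  split; first by left.
  move=> [|[|s]] //=; first by case.
  by move/adjD/(_ D0x).
split.
- move=> [|[|s]] //=; first by apply: closedU => //; exact: closed_closure.
  by apply: closedI => //; exact: open_closedC.
- split.
  + by move=> s p /D'D [->//|/Dn].
  + move=> p; have [[|[|s]] Ds] := covD p.
    * by exists 0; left.
    * have [Np|Np] := pselect (N p); last by exists 1.
      by exists 0; right; exact: subset_closure.
    * by exists s.+2; exact: Ds.
  + move=> [//|s] [|t] p; last first.
      by move=> /D'D[//|Ds] /D'D[//|Dt]; exact: adjD Ds Dt.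
    case: s => [//|s] /= Ds [D0|Np]; first exact: adjD Ds D0.
    by case: (N2 _ _ Ds _ Np).
- move=> [|[|s]] /= [p Dp].
  + by exists V => // q [/DV//|/NV[]].
  + have [|W UW DW] := fD 1; first by exists p; case: Dp.
    by exists W => // q [/DW].
  + by apply: fD; exists p.
- move=> p Sp; have [Dnp np] := SD p Sp; split.
    case: n {SD np Dn} Dnp => [|[|n]] //=; first by left.
    by move=> Dp; split=> // /subset_closure; exact: NS.
  by move=> [|s] /=; [move=> [/np//|/(NS _ Sp)]|case: s => [[/np]|s /np]].
Qed.

Hypothesis opp : forall K, subcontinuum K -> K x -> forall p, K p -> S p -> K = setT.

(* The component P of x in D_1 + ... + D_n reaches at most link j.  A clopen piece F
   around P, read backwards, is put in front of the rest of the chain.  In the new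
   chain the component of x off the first link does not contain P, hence is
   contained in P, and so reaches at most link j - 1. *)
Lemma spiral j n D : fine_chain S n D -> (exists q, forall s, D s q -> s = 0) ->
  (forall C, connected C -> C `<=` links D (fun s => 0 < s) -> C x ->
    C `<=` links D (fun s => 0 < s <= j)) ->
  exists m D', fine_chain S m D' /\ first x D'.
Proof.
elim: j n D => [|j IH] n D fcD [q0 q0D] Cj.
  have [D0x|D0x] := pselect (D 0 x); first exact: fine_chain_first fcD D0x.
  have [_ [_ covD _] _ _] := fcD.
  have [s Ds] := covD x.
  (* No index satisfies [0 < s <= 0], so the singleton of [x] shows that [x] lies in link 0. *)
  have [||||t ? _] := Cj [set x] _ _ _ x => //; last by lia.
  - exact: connected1.
  - by move=> _ ->; exists s => //; case: s Ds.
have [D0x|D0x] := pselect (D 0 x); first exact: fine_chain_first fcD D0x.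
have [cD [Dn covD adjD] fD SD] := fcD.
pose E := links D (fun s => 0 < s).
have cE : closed E by exact: (closed_links cD Dn).
have Ex : E x by have [[|s] Ds] := covD x => //; exists s.+1.
pose P := connected_component E x.
have conP : connected P by exact: component_connected.
have PE : P `<=` E by exact: connected_component_sub.
have Px : P x by exact: connected_component_refl.
have [Pj|] := pselect (P `<=` links D (fun s => 0 < s <= j)).
  apply: (IH n D) => //; first by exists q0.
  by move=> C conC CE Cx; apply: subset_trans Pj; exact: connected_component_max.
move=> /existsNP[p1 /not_implyP[Pp1 p1j]].
have Dp1 : D j.+1 p1.
  have [s sj Ds] := Cj P conP PE Px p1 Pp1.
  have [<-//|sj'] := eqVneq s j.+1.
  by case: p1j; exists s => //; lia.
have [|V UV DV] := fD j.+1; first by exists p1.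
(* [F] has to avoid this set, so that its part beyond link [j] fits into the single member [V] of
   [U]. *)
have cB : closed ((links D (fun s => j.+1 < s) `&` ~` V) `|` S).
  apply: closedU => //; apply: closedI; first exact: (closed_links cD Dn).
  by apply: open_closedC; exact: oU.
have [|F [G [[cF cG FG EFG] Fx FB]]] := clopen_cut cX hX cE cB Ex.
  move=> C conC CE Cx q Cq [[[u uj Du] Vq]|Sq].
    have [t tj Dt] := Cj C conC CE Cx q Cq.
    have e : t = j.+1 by have := adjD _ _ _ Du Dt; lia.
    by apply: Vq; apply: DV; rewrite -e.
  (* A connected set from [x] to [S] has closure [X], but [q0] lies outside the closed set [E]. *)
  have KT := opp (closure_subcontinuum cX conC) (subset_closure Cx) (subset_closure Cq) Sq.
  have [s s0 /q0D s0'] : E q0; last by rewrite s0' in s0.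
  by apply: (closure_minimal cE CE); rewrite KT.
have FS p : F p -> S p -> False by move=> /FB h Sp; apply: h; right.
have FV p s : F p -> D s p -> j < s -> V p.
  move=> Fp Ds sj; have [e|sj'] := eqVneq s j.+1; first by apply: DV; rewrite -e.
  apply: contrapT => Vp; apply: (FB p Fp); left; split=> //; exists s => //; lia.
have FD p : F p -> exists2 s, 0 < s & D s p by move=> Fp; apply/EFG; left.
have conF C : connected C -> C `<=` E -> C x -> C `<=` F.
  move=> conC CE Cx q Cq; apply: contrapT => Fq.
  have [|||||r [_]] := @connected_cover X C F G x q conC cF cG => //.
  - by move=> r /CE /EFG.
  - by have [|] := (EFG q).1 (CE _ Cq).
  - exact: FG.
(* The part of [F] beyond link [j] collapses to link 0, the rest of [F] is reversed, the old link 0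
   gets index [j.+1], and [G] follows. *)
pose D' s := [set p | s = 0 /\ (F `&` links D (fun t => j < t)) p] `|`
  [set p | 0 < s <= j /\ (F `&` D (j.+1 - s)) p] `|`
  [set p | s = j.+1 /\ D 0 p] `|` [set p | j.+1 < s /\ (G `&` D (s - j.+1)) p].
have fcD' : fine_chain S (n + j.+1) D'.
  split.
  - move=> s; repeat apply: closedU; apply: closed_guard => //;
      apply: closedI => //; exact: (closed_links cD Dn).
  - split.
    + move=> s p [[[[->//]|[sj [_ /Dn ?]]]|[-> _]]|[sj [_ /Dn ?]]]; lia.
    + move=> p; have [t Dt] := covD p.
      have [t0|t0] := posnP t.
        by exists j.+1; left; right; split=> //; rewrite -t0.
      have [Fp|Gp] : F p \/ G p by apply/EFG; exists t.
        have [tj|tj] := ltnP j t; first by exists 0; left; left; left; split=> //; split=> //; exists t.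
        exists (j.+1 - t); left; left; right; split; first by lia.
        by split=> //; have -> : j.+1 - (j.+1 - t) = t by lia.
      by exists (t + j.+1); right; split; [lia|split=> //; rewrite addnK].
    + move=> s t p.
      have nFG := FG p.
      move=> [[[[-> [Fs [u uj Ds]]]|[sj [Fs Ds]]]|[-> Ds]]|[sj [Fs Ds]]]
        [[[[-> [Ft [v vj Dt]]]|[tj [Ft Dt]]]|[-> Dt]]|[tj [Ft Dt]]] //;
      try (by exfalso; tauto); try lia;
      by have := adjD _ _ _ Ds Dt; have := adjD _ _ _ Dt Ds; lia.
  - move=> s [p0 Dp0].
    have [s0|s0] := posnP s.
      exists V => // p; rewrite s0 => -[[[[_ [Fp [t tj Dt]]]|[//]]|[//]]|[//]].
      exact: FV Fp Dt tj.
    have [t tP] : exists t, D' s `<=` D t.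
      have [sj|sj|sj] := ltngtP s j.+1.
      + exists (j.+1 - s) => p [[[[?]|[_ []//]]|[?]]|[?]]; lia.
      + exists (s - j.+1) => p [[[[?]|[? _]]|[?]]|[_ []//]]; lia.
      + exists 0 => p [[[[?]|[? _]]|[//]]|[?]]; lia.
    have [|W UW DW] := fD t; first by exists p0; exact: tP.
    by exists W => //; exact: subset_trans tP DW.
  - move=> p Sp; have [Dnp np] := SD p Sp; split.
      have [n0|n0] := posnP n.
        by left; right; split; [lia|rewrite -n0].
      right; split; first by lia.
      have [/FS//|Gp] : F p \/ G p by apply/EFG; exists n.
      by split=> //; rewrite addnK.
    move=> s [[[[_ [/FS//]]|[_ [/FS//]]]|[-> /np]]|[sj [_ /np]]]; lia.
have [D'0x|D'0x] := pselect (D' 0 x); first exact: fine_chain_first fcD' D'0x.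
have j0 : 0 < j.
  rewrite lt0n; apply/eqP => j0; apply: D'0x; left; left; left; split=> //; split=> //.
  by rewrite j0.
have Fp1 : F p1 by exact: (conF P).
(* [p1] plays the role of [q0] for [D'], and it keeps the new component from containing [P]. *)
have p1D' s : D' s p1 -> s = 0.
  move=> [[[[]//|[sj [_ Ds]]]|[_ D0]]|[_ [/(FG _ Fp1)//]]].
    by case: p1j; exists (j.+1 - s) => //; lia.
  by have := adjD _ _ _ Dp1 D0; lia.
apply: (IH _ D' fcD'); first by exists p1.
move=> C conC CE' Cx.
have [_ [D'n _ _] _ _] := fcD'; have [cD' _ _ _] := fcD'.
have cE' : closed (links D' (fun s => 0 < s)) by exact: (closed_links cD' D'n).
have CE : C `<=` E.
  have [//|PE'] := connected_comparable cX hi cE' cE conC conP CE' PE Cx Px.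
  by have [s s0 /p1D' s0'] := PE' _ Pp1; rewrite s0' in s0.
move=> q Cq; have Fq : F q by exact: (conF C).
have [s s0 D's] := CE' _ Cq.
have [sj|sj] := leqP s j; first by exists s => //; lia.
(* A point of [C] in [D' j.+1] comes from [D 0]; being in [F] it also lies in [D 1], hence in
   [D' j]. *)
exists j; first by lia.
left; left; right; split; first by lia.
split=> //; have -> : j.+1 - j = 1 by lia.
move: D's => [[[[]|[]]|[_ D0]]|[_ [/(FG _ Fq)//]]]; try lia.
have [u u0 Du] := FD q Fq.
have := adjD _ _ _ Du D0 => u1.
by have <- : u = 1 by lia.
Qed.

Lemma fine_chain_irredundant n D : fine_chain S n D ->
  exists m D', fine_chain S m D' /\ exists q, forall s, D' s q -> s = 0.
Proof.
elim: n D => [|n IH] D fcD; have [cD [Dn covD adjD] fD SD] := fcD.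
  by exists 0, D; split=> //; exists x => s /Dn; lia.
have [q0|none] := pselect (exists q, forall s, D s q -> s = 0).
  by exists n.+1, D.
apply: (IH (fun s => D s.+1)); split=> //.
- split.
  + by move=> s p /Dn; lia.
  + move=> p; apply: contrapT => np; apply: none; exists p.
    by move=> [//|s] Ds; case: np; exists s.
  + by move=> s t p Ds Dt; have := adjD _ _ _ Ds Dt; lia.
- by move=> s [p Dp]; apply: fD; exists p.
- move=> p Sp; have [Dnp np] := SD p Sp; split=> // s /np; lia.
Qed.

Lemma fine_chain_from n D : fine_chain S n D ->
  exists m D', fine_chain S m D' /\ first x D'.
Proof.
move=> /fine_chain_irredundant[m [D' [fcD' q0]]].
apply: (spiral (j := m) fcD' q0) => C _ CE _ p /CE[s s0 Ds].
by exists s => //; have [_ [D'n _ _] _ _] := fcD'; rewrite s0; exact: D'n Ds.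
Qed.

End Spiral.

(** The point secured in the first link becomes the protected set of the last one. *)
Lemma fine_chain_rev (X : topologicalType) U n (D : nat -> set X) x :
  fine_chain U set0 n D -> first x D ->
  exists2 D', fine_chain U [set x] n D' & D' n x.
Proof.
move=> [cD [Dn covD adjD] fD _] [D0x xD].
exists (fun s => [set p | s <= n /\ D (n - s) p]); last by rewrite /= leqnn subnn.
split.
- by move=> s; exact: closed_guard.
- split.
  + by move=> s p [].
  + move=> p; have [s Ds] := covD p; exists (n - s); split; first exact: leq_subr.
    by rewrite subKn //; exact: Dn Ds.
  + by move=> s t p [sn Ds] [tn Dt]; have := adjD _ _ _ Dt Ds; lia.
- move=> s [p [sn Dp]]; have [|V UV DV] := fD (n - s); first by exists p.
  by exists V => // q [_ /DV].
- move=> _ ->; split; first by rewrite /= leqnn subnn.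
  by move=> s [sn /xD]; lia.
Qed.

(** The spiral is run twice: from [z] with nothing protected and, after reversal, from [x] with [z]
    protected. *)
Lemma fine_closed_chain (X : topologicalType) (U : set (set X)) n D (x z : X) :
  compact [set: X] -> hausdorff_space X -> hereditarily_indecomposable X ->
  (forall V, U V -> open V) -> x <> z ->
  (forall K : set X, subcontinuum K -> K x -> K z -> K = setT) ->
  fine_chain U set0 n D ->
  exists m D', closed_chain x z m D' /\ subordinate U D'.
Proof.
move=> cX hX hi oU xz opp fcD.
have [|||m1 [D1 [fc1 z1]]] := @fine_chain_from X cX hX hi U oU z set0 _ _ _ n D fcD => //.
  exact: closed0.
have [D2 fc2 _] := fine_chain_rev fc1 z1.
have [|||m [D' [[cD' wD' fD' zD'] [D'0 xD']]]] :=
  @fine_chain_from X cX hX hi U oU x [set z] _ _ _ m1 D2 fc2 => //.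
- exact: closed_point.
- by move=> K sK Kx p Kp pz; apply: opp => //; rewrite -pz.
have [D'z zD''] := zD' z erefl.
by exists m, D'; split.
Qed.

(** * Refining two chains along a common walk *)


Definition open_chain (X : topologicalType) (x z : X) n (O : nat -> set X) :=
  [/\ forall s, open (O s), weak_chain n O & ends x z n O].

Section Refinement.
Variable X : topologicalType.
Hypothesis cX : compact [set: X].
Hypothesis hX : hausdorff_space X.

Lemma shrink_cover n (O : nat -> set X) : (forall s, open (O s)) ->
  weak_chain n O ->
  exists D, [/\ forall s, closed (D s), forall s, D s `<=` O s & weak_chain n D].
Proof.
move=> oO [On covO adjO].
(* Links are shrunk one at a time, the shrunk and the untouched ones still covering; above [n] the
   untouched ones are empty. *)
have [V [oV VO covV]] : exists V : nat -> set X, [/\ forall s, open (V s),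
    forall s, closure (V s) `<=` O s &
    forall p, (exists2 s, s < n.+1 & V s p) \/ (exists2 s, n.+1 <= s & O s p)].
  elim: n.+1 => [|k [V [oV VO covV]]].
    exists (fun=> set0); split=> [s|s|p]; first exact: open0.
      by rewrite closure0.
    by right; have [s Os] := covO p; exists s.
  pose A := ~` ((\bigcup_(s in [set s | s < k]) V s) `|` \bigcup_(s in [set s | k < s]) O s).
  have [|||W [oW AW WO]] := @normal_shrink X cX hX A (O k) => //.
  - by apply: open_closedC; apply: openU; apply: bigcup_open.
  - move=> p Ap; have [[s sk Vs]|[s ks Os]] := covV p.
      by case: Ap; left; exists s.
    have [<-//|sk] := eqVneq s k.
    by case: Ap; right; exists s => //=; lia.
  exists (fun s => if s == k then W else V s); split=> [s|s|p].
  - by case: eqP.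
  - by case: eqP => [->|].
  - have [Ap|/contrapT[[s sk Vs]|[s ks Os]]] := pselect (A p).
    + by left; exists k => //; rewrite eqxx; exact: AW.
    + by left; exists s; [rewrite /= in sk; lia|rewrite ltn_eqF].
    + by right; exists s.
exists (fun s => closure (V s)); split=> // [s|]; first exact: closed_closure.
split.
- by move=> s p /VO /On.
- move=> p; have [[s _ Vs]|[s ns /On]] := covV p; last by lia.
  by exists s; exact: subset_closure.
- by move=> s t p /VO Os /VO Ot; exact: adjO Os Ot.
Qed.

Lemma shrink_chain x z n O : open_chain x z n O ->
  exists2 D : nat -> set X, closed_chain x z n D & forall s, D s `<=` O s.
Proof.
move=> [oO wO [O0x xO Onz zO]].
have [D [cD DO wD]] := shrink_cover oO wO.
exists D => //; split=> //; have [_ covD _] := wD; split.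
- by have [s Ds] := covD x; have <- : s = 0 by exact/xO/DO.
- by move=> s /DO /xO.
- by have [s Ds] := covD z; have <- : s = n by exact/zO/DO.
- by move=> s /DO /zO.
Qed.

Lemma swell_chain x z n D (W : nat -> set X) : closed_chain x z n D ->
  (forall s, s <= n -> open (W s)) -> (forall s, s <= n -> D s `<=` W s) ->
  exists2 O, open_chain x z n O & forall s, s <= n -> closure (O s) `<=` W s.
Proof.
move=> [cD [Dn covD adjD] [D0x xD Dnz zD]] oW DW.
(* What the swollen link [s] must avoid: later non-neighbours, and [x] or [z] when [s] is not its
   index. *)
pose H s := links D (fun t => s.+1 < t) `|`
  ([set p | s <> 0 /\ [set x] p] `|` [set p | s <> n /\ [set z] p]).
have cH s : closed (H s).
  apply: closedU; first exact: (closed_links cD Dn).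
  by apply: closedU; apply: closed_guard; exact: closed_point.
have /choice[V VP] s : exists V, s <= n ->
    [/\ open V, D s `<=` V & closure V `<=` W s `&` ~` H s].
  have [sn|ns] := leqP s n; last by exists set0.
  have [|||V VP] := @normal_shrink X cX hX (D s) (W s `&` ~` H s) => //.
  - by apply: openI; [exact: oW|exact: closed_openC].
  - move=> p Dp; split; first exact: DW.
    move=> [[t st Dt]|[[s0 px]|[sn' pz]]].
    + by have := adjD _ _ _ Dt Dp; lia.
    + by apply: s0; apply: xD; rewrite -px.
    + by apply: sn'; apply: zD; rewrite -pz.
  by exists V.
pose C t := [set p | t <= n /\ closure (V t) p].
have cC t : closed (C t) by apply: closed_guard; exact: closed_closure.
(* Removing earlier closures only keeps O s open and still separates both sides. *)
pose O s := [set p | s <= n /\ (V s `\` links C (fun t => t.+1 < s)) p].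
have OV s : O s `<=` V s by move=> p [_ []].
have DO s : D s `<=` O s.
  move=> p Dp; have sn := Dn _ _ Dp; have [_ DV _] := VP s sn.
  split=> //; split; first exact: DV.
  move=> [t ts [tn Vt]]; have [_ _ VW] := VP t tn.
  by have [_] := VW _ Vt; apply; left; exists s.
have OH s p : O s p -> ~ H s p.
  move=> [sn [Vp _]]; have [_ _ VW] := VP s sn.
  by have [] := VW _ (subset_closure Vp).
exists O; last first.
  move=> s sn; have [_ _ VW] := VP s sn.
  apply: subset_trans (closure_subset (@OV s)) _ => p /VW[] //.
split.
- move=> s; have [sn|ns] := leqP s n; last first.
    rewrite (_ : O s = set0); first exact: open0.
    by rewrite predeqE => p; split=> // -[]; rewrite leqNgt ns.
  have [oV _ _] := VP s sn.
  rewrite (_ : O s = V s `\` links C (fun t => t.+1 < s)).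
    apply: openI => //; apply: closed_openC; apply: (closed_links (n := n) cC).
    by move=> t p [].
  by rewrite predeqE => p; split=> [[]|].
- split.
  + by move=> s p [].
  + by move=> p; have [s /DO Os] := covD p; exists s.
  + move=> s t p [sn [_ nC]] [tn [Vt _]].
    rewrite leqNgt; apply/negP => ts; apply: nC; exists t => //; split=> //.
    exact: subset_closure.
- split.
  + exact: DO.
  + by move=> s /OH h; apply: contrapT => s0; apply: h; right; left.
  + exact: DO.
  + by move=> s /OH h; apply: contrapT => s0; apply: h; right; right.
Qed.

Lemma chainable_refinement (U : set (set X)) : chainable X -> open_cover U ->
  exists n O, [/\ forall s, open (O s), weak_chain n O & subordinate U O].
Proof.
move=> chX /chX[n [O [[[oO covO] adjO] refO]]].
pose O' s := [set p | exists2 i : 'I_n.+1, i = s :> nat & O i p].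
have O'E (i : 'I_n.+1) : O' i = O i.
  rewrite predeqE => p; split=> [[j /val_inj -> //]|Oi]; by exists i.
exists n, O'; split.
- move=> s; have [sn|ns] := ltnP s n.+1.
    by have := O'E (Ordinal sn) => /= ->; apply: oO; exists (Ordinal sn).
  rewrite (_ : O' s = set0); first exact: open0.
  by rewrite predeqE => p; split=> // -[i is_ _]; have := ltn_ord i; rewrite is_ ltnNge ns.
- split.
  + by move=> s p [i <- _]; rewrite -ltnS.
  + move=> p; have : [set: X] p by []; rewrite -covO => -[_ [i _ <-] Op].
    by exists i; exists i.
  + move=> _ _ p [i <- Oi] [j <- Oj].
    by have /adjO : O i `&` O j !=set0; [exists p|lia].
- move=> s [p [i <- Oi]]; have [|V UV OV] := refO (O i); first by exists i.
  by exists V => //; rewrite O'E.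
Qed.

Hypothesis conX : connected [set: X].

(** The links up to [s] and the later ones form two closed sets covering connected [X], one
    containing [x], the other [z]. *)
Lemma chain_linked x z n D s : closed_chain x z n D -> s < n ->
  exists p : X, D s p /\ D s.+1 p.
Proof.
move=> [cD [Dn covD adjD] [D0x _ Dnz _]] sn.
have cL P : closed (links D P) by exact: (closed_links cD Dn).
have [|||||p [_ [a as_ Da] [b sb Db]]] := @connected_cover X setT
  (links D (fun t => t <= s)) (links D (fun t => s < t)) x z conX (cL _) (cL _) => //.
- move=> p _; have [t Dt] := covD p.
  by have [ts|st] := leqP t s; [left|right]; exists t.
- by exists 0.
- by exists n.
have ba := adjD _ _ _ Db Da.
by exists p; split; [have <- : a = s by lia|have <- : b = s.+1 by lia].
Qed.

Lemma chain_nonempty x z n D s : closed_chain x z n D -> s <= n ->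
  exists p : X, D s p.
Proof.
move=> chD; rewrite leq_eqVlt => /predU1P[->|sn].
  by exists z; case: chD => _ _ [].
by have [p [Dp _]] := chain_linked chD sn; exists p.
Qed.

Hypothesis hi : hereditarily_indecomposable X.
Hypothesis chX : chainable X.

(** Half a round of the back and forth: the chain from [x] to [z] becomes fine, and the one from [y]
    to [w] follows its walk. *)
Lemma chain_step (U : set (set X)) x z y w n O Q : open_cover U ->
  x <> z -> (forall K : set X, subcontinuum K -> K x -> K z -> K = setT) ->
  y <> w -> open_chain x z n O -> open_chain y w n Q ->
  exists m r (O' Q' : nat -> set X), [/\ open_chain x z m O', open_chain y w m Q',
    forall s, s <= m -> closure (O' s) `<=` O (r s),
    forall s, s <= m -> closure (Q' s) `<=` Q (r s)
    & forall s, s <= m -> exists2 V, U V & O' s `<=` V].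
Proof.
move=> [oU covU] xz opp yw chO chQ.
have [oO [On covO adjO] [O0x xO Onz zO]] := chO.
pose UO := [set A | exists V t, U V /\ A = V `&` O t].
have oUO A : UO A -> open A by move=> [V [t [UV ->]]]; apply: openI; [exact: oU|].
have ocUO : open_cover UO.
  split=> //; rewrite predeqE => p; split=> // _.
  have : [set: X] p by []; rewrite -covU => -[V UV Vp].
  by have [t Ot] := covO p; exists (V `&` O t) => //; exists V, t.
have [n0 [O0 [oO0 wO0 fO0]]] := chainable_refinement chX ocUO.
have [D0 [cD0 DO0 wD0]] := shrink_cover oO0 wO0.
have fc0 : fine_chain UO set0 n0 D0.
  split=> // s [p Dp]; have [|V UV OV] := fO0 s; first by exists p; exact: DO0.
  by exists V => // q /DO0 /OV.
have [m [D [chD fD]]] := fine_closed_chain cX hX hi oUO xz opp fc0.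
have /choice[Vr VrP] s : exists Vr : set X * nat, s <= m ->
    U Vr.1 /\ D s `<=` Vr.1 `&` O Vr.2.
  have [sm|ms] := leqP s m; last by exists (set0, 0).
  have [p Dp] := chain_nonempty chD sm.
  have [|A [V [t [UV ->]]] DA] := fD s; first by exists p.
  by exists (V, t).
pose r s := (Vr s).2.
have DO s p : s <= m -> D s p -> O (r s) p.
  by move=> sm Dp; have [_ h] := VrP s sm; have [] := h _ Dp.
have [cD wD [D0x _ Dmz _]] := chD.
(* Consecutive links of [D] share a point, so the chosen links of [O] overlap; the ends are fixed
   since [x] and [z] lie in one link of [O] each. *)
have walkr : walk m n r.
  split.
  - by apply: xO; apply: DO.
  - by apply: zO; apply: DO.
  - move=> s sm; have [p [Dp Dp']] := chain_linked chD sm.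
    have Os := DO s p (ltnW sm) Dp; have Os' := DO s.+1 p sm Dp'.
    by split; [exact: adjO Os' Os|exact: adjO Os Os'].
  - move=> s sm; have [p Dp] := chain_nonempty chD sm.
    exact: On (DO s p sm Dp).
have [|s sm|O' chO' O'W] := @swell_chain x z m D (fun s => (Vr s).1 `&` O (r s)) chD.
- by move=> s sm; apply: openI => //; apply: oU; have [] := VrP s sm.
- by have [] := VrP s sm.
have [E chE EQ] := shrink_chain chQ.
have [E' chE' E'E] := lift_walk cX hX hi yw walkr chE.
have [||Q' chQ' Q'Q] := @swell_chain y w m E' (fun s => Q (r s)) chE'.
- by move=> s _; case: chQ.
- by move=> s sm p /(E'E s sm)/EQ.
exists m, r, O', Q'; split=> // s sm.
- by move=> p /(O'W s sm)[].
- exists (Vr s).1; first by have [] := VrP s sm.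
  by move=> p /subset_closure /(O'W s sm)[].
Qed.

End Refinement.

(** * Back and forth *)


(* A strong development in the sense of metrization theory: some cover has the
   double star of b inside W. *)
Definition development (X : topologicalType) (U : nat -> set (set X)) :=
  (forall k, open_cover (U k)) /\
  forall b W, open W -> W b -> exists k, forall V V' r a, U k V -> U k V' ->
    V b -> V r -> V' r -> V' a -> W a.

Lemma metrizable_hausdorff (R : realType) (X : topologicalType) :
  metrizable R X -> hausdorff_space X.
Proof.
move=> [M [f [cf [g [fK gK cg]]]]] p q pq.
rewrite -(fK p) -(fK q); congr g; apply: metric_hausdorff => A B pA qB.
have [||r [Ar Br]] := pq (f @^-1` A) (f @^-1` B).
- exact: cf.
- exact: cf.
- by exists (f r).
Qed.

Lemma metrizable_development (R : realType) (X : topologicalType) :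
  metrizable R X -> exists U : nat -> set (set X), development U.
Proof.
move=> [M [f [cf [g [fK gK cg]]]]].
pose d (a b : X) : R := mdist (f a) (f b).
have dC a b : d a b = d b a by exact: metric_sym.
have dT a b c : (d a c <= d a b + d b c)%R by exact: metric_triangle.
have dball a (e : R) : (0 < e)%R -> nbhs a [set b | (d a b < e)%R].
  move=> e0; have := cf a; move=> /(_ (ball (f a) e)) h.
  by have := h (nbhsx_ballx _ _ e0); rewrite ballEmdist.
exists (fun k => [set V | open V /\ forall a b, V a -> V b -> (d a b < k.+1%:R^-1)%R]).
split=> [k|b W oW Wb].
  split=> [V [] //|]; rewrite predeqE => p; split=> // _.
  have e0 : (0 < (k.+1%:R^-1 / 2 : R))%R by rewrite divr_gt0 // invr_gt0 ltr0n.
  exists ([set b | (d p b < k.+1%:R^-1 / 2)%R]°); last exact: dball.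
  split=> [|a b /interior_subset /= pa /interior_subset /= pb]; first exact: open_interior.
  apply: le_lt_trans (dT _ p _) _; rewrite [in ltRHS](splitr k.+1%:R^-1)%R.
  by apply: ltrD => //; rewrite dC.
have : nbhs (f b) (g @^-1` W).
  by apply: cg; rewrite fK; exact: open_nbhs_nbhs.
rewrite -nbhs_ballE => -[e /= e0]; rewrite ballEmdist => eW.
have [k ke] : exists k : nat, (k.+1%:R^-1 < e / 2)%R.
  have e20 : (0 < e / 2)%R by rewrite divr_gt0.
  exists (Num.trunc (e / 2)^-1).
  by rewrite invf_plt ?posrE // truncnS_gt.
exists k => V V' r a [_ dV] [_ dV'] Vb Vr V'r V'a.
rewrite -(fK a); apply: eW => /=.
apply: le_lt_trans (dT b r a) _; rewrite [ltRHS]splitr.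
by apply: ltrD; apply: lt_trans ke; [exact: dV|exact: dV'].
Qed.

Lemma development_pi_base (X : topologicalType) (U : nat -> set (set X)) (p : X) :
  chainable X -> development U ->
  exists B : nat -> set X, (forall i, open (B i) /\ B i !=set0) /\
    forall q W, open W -> W q -> exists i, B i `<=` W.
Proof.
move=> chX [ocU devU].
have /choice[O OP] k : exists O : nat -> set X,
    [/\ forall s, open (O s), forall q, exists s, O s q & subordinate (U k) O].
  by have [n [O [oO [_ covO _] fO]]] := chainable_refinement chX (ocU k); exists O.
(* Empty links and codes of no pair are replaced by the whole space, to keep every [B i]
   nonempty. *)
pose B i := if unpickle i is Some ks then
  if pselect (O ks.1 ks.2 !=set0) then O ks.1 ks.2 else setT else [set: X].
exists B; split=> [i|q W oW Wq].
  rewrite /B; case: unpickle => [[k s]|] /=; last by split; [exact: openT|exists p].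
  case: pselect => h; last by split; [exact: openT|exists p].
  by split=> //; have [oO _ _] := OP k; exact: oO.
have [k kW] := devU q W oW Wq; have [_ covO fO] := OP k.
have [s Os] := covO q; exists (pickle (k, s)); rewrite /B pickleK /=.
have h : O k s !=set0 by exists q.
case: pselect => [h' /= a Oa|//]; have [V UV OV] := fO s h.
by apply: (kW V V q a) => //; apply: OV.
Qed.

Section Limit.
Variable X : topologicalType.
Hypothesis cX : compact [set: X].
Hypothesis hX : hausdorff_space X.
Hypothesis conX : connected [set: X].
Variable U : nat -> set (set X).
Hypothesis devU : development U.
Variables (x z y w : X) (n : nat -> nat) (O Q : nat -> nat -> set X).
Hypothesis chO : forall k, open_chain x z (n k) (O k).
Hypothesis chQ : forall k, open_chain y w (n k) (Q k).
Hypothesis OQ : forall k, exists r, forall s, s <= n k.+1 ->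
  closure (O k.+1 s) `<=` O k (r s) /\ closure (Q k.+1 s) `<=` Q k (r s).
Hypothesis subQ : forall k s, s <= n k.+1 -> exists2 V, U k V & Q k.+1 s `<=` V.

(** The graph of the limit homeomorphism. *)
Definition matched a b := forall k, exists2 s, O k s a & Q k s b.

Lemma matched_total a : exists b, matched a b.
Proof.
pose T k := links (fun s => closure (Q k s)) (fun s => O k s a).
have cT k : closed (T k).
  apply: (closed_links (n := n k)) => [s|s p]; first exact: closed_closure.
  have [_ [Qn _ _] _] := chQ k.
  have [//|ns] := leqP s (n k); rewrite (_ : Q k s = set0) ?closure0 //.
  by rewrite predeqE => q; split=> // /Qn; rewrite leqNgt ns.
(* Closures at stage [k.+1] lie in links at stage [k], so a point of all [T k] lies in the links
   themselves. *)
have TQ k p : T k.+1 p -> exists2 s, O k s a & Q k s p.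
  move=> [s Os Qs]; have [r rOQ] := OQ k.
  have sn : s <= n k.+1 by have [_ [On _ _] _] := chO k.+1; exact: On Os.
  have [h1 h2] := rOQ s sn.
  by exists (r s); [exact/h1/subset_closure|exact: h2].
have TS k : T k.+1 `<=` T k.
  by move=> p /TQ[s Os Qs]; exists s => //; exact: subset_closure.
have Tmono i j : i <= j -> T j `<=` T i.
  elim: j => [|j IH]; first by rewrite leqn0 => /eqP ->.
  rewrite leq_eqVlt => /predU1P[->//|]; rewrite ltnS => /IH.
  by apply: subset_trans; exact: TS.
have [[b bT]|none] := pselect (exists b, forall k, T k b).
  by exists b => k; exact/TQ/bT.
have [|||||_ [k ->] T0] := @directed_closed_sub X cX [set A | exists k, A = T k] set0.
- by exists (T 0); exists 0.
- by move=> _ [k ->].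
- move=> _ _ [i ->] [j ->]; exists (T (maxn i j)); first by exists (maxn i j).
  by move=> p Tp; split; apply: Tmono Tp; rewrite ?leq_maxl ?leq_maxr.
- exact: open0.
- by move=> b h; apply: none; exists b => k; apply: h; exists k.
have [_ [On covO _] _] := chO k; have [s Os] := covO a.
have [D chD DQ] := shrink_chain cX hX (chQ k).
have [p Dp] := chain_nonempty conX chD (On _ _ Os).
by case: (T0 p); exists s => //; exact/subset_closure/DQ.
Qed.

(** Points sharing a link of [O] with [a] have partners in the same or an adjacent link of [Q].
    Adjacent links meet since [X] is connected, so the partner lies in the double star of [b]. *)
Lemma matched_continuous a b W : matched a b -> open W -> W b ->
  exists N, [/\ open N, N a & forall a' b', N a' -> matched a' b' -> W b'].
Proof.
move=> ab oW Wb; have [_ /(_ b W oW Wb)[k kW]] := devU.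
have [s Os Qs] := ab k.+1.
have [oO [On _ adjO] _] := chO k.+1.
exists (O k.+1 s); split=> // a' b' Oa' /(_ k.+1)[t Ot Qt].
have sn := On _ _ Os; have tn := On _ _ Ot.
have st := adjO _ _ _ Oa' Ot; have ts := adjO _ _ _ Ot Oa'.
have [V UV QV] := subQ sn; have [V' UV' QV'] := subQ tn.
have [D chD DQ] := shrink_chain cX hX (chQ k.+1).
have [r Qsr Qtr] : exists2 r, Q k.+1 s r & Q k.+1 t r.
  have [e|lt_st|lt_ts] := ltngtP s t; last by exists b; rewrite // -lt_ts.
  - have [|r [Dr Dr']] := chain_linked conX chD (s := s); first by lia.
    have -> : t = s.+1 by lia.
    by exists r; exact: DQ.
  - have [|r [Dr Dr']] := chain_linked conX chD (s := t); first by lia.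
    have -> : s = t.+1 by lia.
    by exists r; exact: DQ.
by apply: (kW V V' r b') => //; [exact: QV|exact: QV|exact: QV'|exact: QV'].
Qed.

Lemma matched_unique a b b' : matched a b -> matched a b' -> b = b'.
Proof.
move=> ab ab'; apply: contrapT => bb'.
have oW : open (~` [set b']) by apply: closed_openC; exact: closed_point.
have [N [_ Na NW]] := matched_continuous ab oW bb'.
exact: NW Na ab' erefl.
Qed.

End Limit.

Lemma homeomorphism_of_matched (X : topologicalType) (G : X -> X -> Prop) :
  (forall a, exists b, G a b) -> (forall b, exists a, G a b) ->
  (forall a b b', G a b -> G a b' -> b = b') ->
  (forall a a' b, G a b -> G a' b -> a = a') ->
  (forall a b W, G a b -> open W -> W b ->
    exists N, [/\ open N, N a & forall a' b', N a' -> G a' b' -> W b']) ->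
  (forall a b W, G a b -> open W -> W a ->
    exists N, [/\ open N, N b & forall a' b', N b' -> G a' b' -> W a']) ->
  exists2 phi : X -> X, homeomorphism phi & forall a, G a (phi a).
Proof.
move=> /choice[f fG] /choice[g gG] fun1 fun2 c1 c2.
exists f => //; split; last first.
  exists g; split.
  - by move=> a; exact: fun2 (gG (f a)) (fG a).
  - by move=> b; exact: fun1 (fG (g b)) (gG b).
  - move=> b A; rewrite nbhsE => -[W [oW Wb] WA].
    have [N [oN Nb NW]] := c2 _ _ W (gG b) oW Wb.
    rewrite nbhs_simpl /=; rewrite nbhsE; exists N; first by split.
    by move=> b' Nb'; apply: WA; exact: NW Nb' (gG b').
move=> a A; rewrite nbhsE => -[W [oW Wa] WA].
have [N [oN Na NW]] := c1 _ _ W (fG a) oW Wa.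
rewrite nbhs_simpl /=; rewrite nbhsE; exists N; first by split.
by move=> a' Na'; apply: WA; exact: NW Na' (fG a').
Qed.

Lemma trivial_open_chain (X : topologicalType) (x z : X) :
  open_chain x z 0 (fun s => if s is 0 then setT else set0).
Proof.
split.
- by case=> [|s]; [exact: openT|exact: open0].
- split.
  + by case.
  + by move=> p; exists 0.
  + by move=> [|s] [|t].
- by split=> // -[].
Qed.

Section Homogeneity.
Variable X : topologicalType.
Hypothesis cX : compact [set: X].
Hypothesis hX : hausdorff_space X.
Hypothesis conX : connected [set: X].
Hypothesis hi : hereditarily_indecomposable X.
Hypothesis chX : chainable X.
Variable U : nat -> set (set X).
Hypothesis devU : development U.

(** A second step with the roles exchanged makes the other chain fine too; the first chain stays
    fine by refinement. *)
Lemma chain_double_step k x z y w n (O Q : nat -> set X) :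
  x <> z -> (forall K : set X, subcontinuum K -> K x -> K z -> K = setT) ->
  y <> w -> (forall K : set X, subcontinuum K -> K y -> K w -> K = setT) ->
  open_chain x z n O -> open_chain y w n Q ->
  exists m (O' Q' : nat -> set X), [/\ open_chain x z m O', open_chain y w m Q',
    exists r, forall s, s <= m ->
      closure (O' s) `<=` O (r s) /\ closure (Q' s) `<=` Q (r s),
    forall s, s <= m -> exists2 V, U k V & O' s `<=` V &
    forall s, s <= m -> exists2 V, U k V & Q' s `<=` V].
Proof.
move=> xz opp yw opp' chO chQ; have [ocU _] := devU.
have [m1 [r1 [O1 [Q1 [chO1 chQ1 O1O Q1Q subO1]]]]] :=
  chain_step cX hX conX hi chX (ocU k) xz opp yw chO chQ.
have [m [r [Q2 [O2 [chQ2 chO2 Q2Q O2O subQ2]]]]] :=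
  chain_step cX hX conX hi chX (ocU k) yw opp' xz chQ1 chO1.
have rm1 s : s <= m -> r s <= m1.
  move=> sm; have [D chD DO] := shrink_chain cX hX chO2.
  have [p Dp] := chain_nonempty conX chD sm.
  have [_ [On _ _] _] := chO1; apply: (On _ p); apply: O2O => //.
  exact/subset_closure/DO.
exists m, O2, Q2; split=> //.
- exists (fun s => r1 (r s)) => s sm; split=> p.
  + by move=> /(O2O s sm)/subset_closure/(O1O _ (rm1 s sm)).
  + by move=> /(Q2Q s sm)/subset_closure/(Q1Q _ (rm1 s sm)).
- move=> s sm; have [V UV OV] := subO1 _ (rm1 s sm).
  by exists V => // p /subset_closure/(O2O s sm)/OV.
Qed.

Lemma homeomorphism_of_opposite_points x z y w :
  x <> z -> (forall K : set X, subcontinuum K -> K x -> K z -> K = setT) ->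
  y <> w -> (forall K : set X, subcontinuum K -> K y -> K w -> K = setT) ->
  exists phi : X -> X, homeomorphism phi /\ phi x = y.
Proof.
move=> xz opp yw opp'.
pose state := (nat * (nat -> set X) * (nat -> set X))%type.
pose good (st : state) := open_chain x z st.1.1 st.1.2 /\ open_chain y w st.1.1 st.2.
pose next k (st st' : state) :=
  [/\ exists r, forall s, s <= st'.1.1 ->
      closure (st'.1.2 s) `<=` st.1.2 (r s) /\ closure (st'.2 s) `<=` st.2 (r s),
    forall s, s <= st'.1.1 -> exists2 V, U k V & st'.1.2 s `<=` V &
    forall s, s <= st'.1.1 -> exists2 V, U k V & st'.2 s `<=` V].
(* [good] is assumed under the existential, so that [step] is defined on every state. *)
have /choice[step stepP] (kst : nat * state) : exists st',
    good kst.2 -> good st' /\ next kst.1 kst.2 st'.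
  have [[chO chQ]|] := pselect (good kst.2); last by exists kst.2.
  have [m [O' [Q' [? ? ? ? ?]]]] := chain_double_step kst.1 xz opp yw opp' chO chQ.
  by exists (m, O', Q').
pose whole s := if s is 0 then [set: X] else set0.
pose fix st k : state := if k is k'.+1 then step (k', st k') else (0, whole, whole).
have stG k : good (st k).
  elim: k => [|k IH]; first by split; exact: trivial_open_chain.
  by have [] := stepP (k, st k) IH.
have stN k : next k (st k) (st k.+1) by have [] := stepP (k, st k) (stG k).
pose n k := (st k).1.1; pose O k := (st k).1.2; pose Q k := (st k).2.
have chO k : open_chain x z (n k) (O k) by have [] := stG k.
have chQ k : open_chain y w (n k) (Q k) by have [] := stG k.
have OQ k : exists r, forall s, s <= n k.+1 ->
  closure (O k.+1 s) `<=` O k (r s) /\ closure (Q k.+1 s) `<=` Q k (r s).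
  by have [] := stN k.
have QO k : exists r, forall s, s <= n k.+1 ->
  closure (Q k.+1 s) `<=` Q k (r s) /\ closure (O k.+1 s) `<=` O k (r s).
  by have [r h] := OQ k; exists r => s /h[].
have subO k s : s <= n k.+1 -> exists2 V, U k V & O k.+1 s `<=` V.
  by have [_ h _] := stN k; exact: h.
have subQ k s : s <= n k.+1 -> exists2 V, U k V & Q k.+1 s `<=` V.
  by have [_ _ h] := stN k; exact: h.
have flip a b : matched O Q a b <-> matched Q O b a.
  by split=> h k; have [s ? ?] := h k; exists s.
have uniq1 := matched_unique cX hX conX devU chO chQ subQ.
have [|||||| phi hphi phiP] := @homeomorphism_of_matched X (matched O Q).
- exact: (matched_total cX hX conX chO chQ OQ).
- move=> b; have [a ba] := matched_total cX hX conX chQ chO QO b.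
  by exists a; exact/flip.
- exact: uniq1.
- move=> a a' b /flip ab /flip a'b.
  exact: (matched_unique cX hX conX devU chQ chO subO ab a'b).
- exact: (matched_continuous cX hX conX devU chO chQ subQ).
- move=> a b W /flip ab oW Wa.
  have [N [oN Nb NW]] := matched_continuous cX hX conX devU chQ chO subO ab oW Wa.
  by exists N; split=> // a' b' Nb' /flip; exact: NW.
(* At every stage [x] and [y] lie in the links of index 0, so they are matched. *)
exists phi; split=> //; apply: (uniq1 x) => // k.
by exists 0; [have [_ _ []] := chO k|have [_ _ []] := chQ k].
Qed.

End Homogeneity.

Theorem theorem4p16 (R : realType) (X : topologicalType) (hX : pseudoarc R X)
    (x y : X) :
  exists phi : X -> X, homeomorphism phi /\ phi x = y.
Proof.
have [[conX cX mX] chX hi [a [b ab]]] := hX.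
have haus := metrizable_hausdorff mX.
have [U devU] := metrizable_development mX.
have [B [oB baseB]] := development_pi_base x chX devU.
have opp p : exists q, p <> q /\
    forall K : set X, subcontinuum K -> K p -> K q -> K = setT.
  have [q qP] := opposite_point cX haus hi conX p oB baseB.
  exists q; split=> // pq.
  (* If [q] were [p], the subcontinuum consisting of [p] alone would be all of [X], which has two
     points. *)
  have pT : [set p] = setT.
    by apply: qP => //; split; [exact: compact_set1|exact: connected1].
  have ap : [set p] a by rewrite pT.
  have bp : [set p] b by rewrite pT.
  by apply: ab; rewrite ap bp.
have [z [xz xzP]] := opp x; have [w [yw ywP]] := opp y.
exact: (homeomorphism_of_opposite_points cX haus conX hi chX devU xz xzP yw ywP).
Qed.
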